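(* Let $X$ be a real inner product space and let $R\subseteq X$ be a bounded subset spanning $X$ (every element of $X$ is a linear combination of finitely many elements of $R$). Let $G$ be a group of orthogonal linear transformations $\pi$ of $X$ with $\pi(R)=R$. Let $H$ be the completion of $X$ (a Hilbert space, on which $G$ acts naturally). Then the following four statements are equivalent: (i) For each positive integer $k$ there exists a finite set $Z\subseteq X$ such that for each $x\in R_k$ there exist $z\in Z$ and $\pi\in G$ with $\langle r,x-z^{\pi}\rangle^2\leq 1$ for every $r\in R$. (ii) For each $\varepsilon>0$ there exists a finite set $Z\subseteq B(X)$ such that for each $x\in B(X)$ there exist $z\in Z$ and $\pi\in G$ with $|\langle r,x-z^{\pi}\rangle|<\varepsilon$ for every $r\in R$. (iii) For each $\varepsilon>0$ and each function $f:X\to\{1,2,\ldots\}$ there exists a finite set $Z\subseteq B(X)$ such that for each $x\in B(X)$ there exist $z\in Z$ and $\pi\in G$ such that $$\sum_{i=1}^{f(z)}|\langle r_i,x-z^{\pi}\rangle|^t\leq \varepsilon\bigl(1+\|(\|r_1\|^t,\ldots,\|r_{f(z)}\|^t)\|_p\bigr)$$ for all $t\in[\varepsilon,2]$, where $p:=2/(2-t)$, and for all pairwise orthogonal $r_1,\ldots,r_{f(z)}\in R$. (iv) The orbit space $(B(H),d_R)/G$ is compact.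
   Context: $B(X)$ denotes the closed unit ball of $X$ and $B(H)$ the closed unit ball of $H$. For $z\in X$ and $\pi\in G$, $z^{\pi}$ denotes the image $\pi(z)$. For a positive integer $k$, $R_k:=\{\pm r_1\pm\cdots\pm r_k\mid r_1,\ldots,r_k\in R\}$. For $x,y\in H$, $d_R(x,y):=\sup_{r\in R}|\langle r,x-y\rangle|$; $(B(H),d_R)$ denotes $B(H)$ with the topology induced by $d_R$, and $(B(H),d_R)/G$ is its orbit space, i.e. the quotient topological space whose classes are the $G$-orbits. In (iii), $\|\cdot\|_p$ is the $L^p$-norm on the finite-dimensional space $\mathbb{R}^{f(z)}$ (for $t=2$, $p=\infty$, i.e. the maximum norm). *)

(* Defs.v *)
From HB Require Import structures.
From mathcomp Require Import all_boot all_order all_algebra.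
From mathcomp Require Import sesquilinear generic_quotient.
From mathcomp Require Import all_classical all_reals all_analysis.

Set Implicit Arguments.
Unset Strict Implicit.
Unset Printing Implicit Defensive.

Import Order.TTheory GRing.Theory Num.Theory.
Import numFieldNormedType.Exports.

Local Open Scope classical_set_scope.
Local Open Scope ring_scope.

(* A real inner product space is a left module [V] over a [realType] [K],
   together with a positive definite symmetric form [dot : {dot V for idfun}]. *)

Section InnerProduct.
Context {K : realType} {V : lmodType K}.
Variable dot : {dot V for @idfun K}.

Definition dot_norm (x : V) : K := Num.sqrt (dot x x).

Definition dot_unit_ball : set V := [set x | dot_norm x <= 1].

Definition dot_bounded (A : set V) : Prop :=
  exists M : K, forall x, A x -> dot_norm x <= M.

Record orthogonal_group (G : set {linear V -> V}) : Prop := {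
  orthogonal_group_isometry : forall p, G p -> isometry dot dot p ;
  orthogonal_group1 : G idfun ;
  orthogonal_groupM : forall p q, G p -> G q -> G (p \o q) ;
  orthogonal_groupV : forall p, G p ->
    exists2 q : {linear V -> V}, G q & cancel p q /\ cancel q p }.

Definition pairwise_orthogonal_family (n : nat) (r : 'I_n -> V) : Prop :=
  forall i j, i != j -> dot (r i) (r j) = 0.

End InnerProduct.

Definition spanning {K : realType} {V : lmodType K} (A : set V) : Prop :=
  forall x, exists (n : nat) (a : 'I_n -> K) (r : 'I_n -> V),
    (forall i, A (r i)) /\ x = \sum_(i < n) a i *: r i.

(* All +- r_1 +- ... +- r_k with r_1, ..., r_k in A, not necessarily distinct;
   the first sign is free as well. *)
Definition signed_sums {K : realType} {V : lmodType K} (A : set V) (k : nat) :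
    set V :=
  [set x | exists (s : 'I_k -> bool) (r : 'I_k -> V),
     (forall i, A (r i)) /\ x = \sum_(i < k) (-1) ^+ s i *: r i].

Definition lp_norm {K : realType} (p : \bar K) (n : nat) (v : 'I_n -> K) : K :=
  match p with
  | p%:E => (\sum_(i < n) `|v i| `^ p) `^ p^-1
  | +oo%E => \big[Num.max/0]_(i < n) `|v i|
  | -oo%E => 0
  end.

Record hilbert_completion {K : realType} {X : lmodType K}
    (dotX : {dot X for @idfun K}) {H : completeNormedModType K}
    (dotH : {dot H for @idfun K}) (iota : {linear X -> H}) : Prop := {
  hilbert_completion_norm : forall h : H, `|h| = dot_norm dotH h ;
  hilbert_completion_isometry : isometry dotH dotX iota ;
  hilbert_completion_dense : dense (range iota) }.

(* The natural action of [G] on the completion: each transformation in [G] has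
   a unique continuous extension to [H], since [iota] has dense range. *)
Definition extended_group {K : realType} {X : lmodType K}
    {H : completeNormedModType K} (iota : {linear X -> H})
    (G : set {linear X -> X}) : set (H -> H) :=
  [set q | continuous q /\
           exists2 p, G p & forall x, q (iota x) = iota (p x)].

(* [d_space dot A] is [V] with the topology of the pseudometric
   d_A(x, y) = sup_(r in A) |<r, x - y>|. The supremum is taken in the extended
   reals, so that the pseudometric structure does not require [A] bounded. *)
Definition d_space {K : realType} {V : lmodType K} (dot : {dot V for @idfun K})
  (A : set V) : Type := V.

Section Pseudometric.
Context {K : realType} {V : lmodType K}.
Variables (dot : {dot V for @idfun K}) (A : set V).

Definition d_sup (x y : V) : \bar K :=
  ereal_sup [set `|dot r (x - y)|%:E | r in A].

Definition d_ball (x : V) (e : K) (y : V) : Prop := (d_sup x y < e%:E)%E.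

Let d_ball_center x (e : K) : 0 < e -> d_ball x e x.
Proof.
move=> e0; rewrite /d_ball; apply: (@le_lt_trans _ _ 0%E); last by rewrite lte_fin.
by apply: ge_ereal_sup => _ [r _ <-]; rewrite subrr linear0r normr0.
Qed.

Let d_ball_sym x y (e : K) : d_ball x e y -> d_ball y e x.
Proof.
rewrite /d_ball; congr (ereal_sup _ < _)%E; apply/seteqP.
by split=> _ [r Ar <-]; exists r => //; rewrite -opprB linearNr normrN.
Qed.

Let d_ball_triangle x y z (e1 e2 : K) :
  d_ball x e1 y -> d_ball y e2 z -> d_ball x (e1 + e2) z.
Proof.
rewrite /d_ball => xy yz; rewrite EFinD.
apply: (@le_lt_trans _ _ (d_sup x y + d_sup y z)%E); last exact: lteD.
apply: ge_ereal_sup => _ [r Ar <-].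
have -> : x - z = (x - y) + (y - z) by rewrite addrA subrK.
rewrite linearDr.
apply: (@le_trans _ _ (`|dot r (x - y)|%:E + `|dot r (y - z)|%:E)%E).
  by rewrite -EFinD lee_fin ler_normD.
by apply: leeD; apply: ereal_sup_ubound; exists r.
Qed.

HB.instance Definition _ := Choice.copy (d_space dot A) V.
HB.instance Definition _ :=
  hasNbhs.Build (d_space dot A) (nbhs_ (entourage_ d_ball)).
HB.instance Definition _ := @Nbhs_isPseudoMetric.Build K (d_space dot A)
  (entourage_ d_ball) erefl d_ball
  d_ball_center d_ball_sym d_ball_triangle erefl.

End Pseudometric.

(* The closed unit ball, with the subspace topology inherited from [d_space],
   modulo the orbits of a group [Q] of transformations. Two points are
   identified when their [Q]-orbits coincide. *)
Section OrbitSpace.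
Context {K : realType} {V : lmodType K}.
Variables (dot : {dot V for @idfun K}) (A : set V) (Q : set (V -> V)).

Definition ball_space : topologicalType :=
  set_type (dot_unit_ball dot : set (d_space dot A)).

Definition ball_orbit (x : ball_space) : set ball_space :=
  [set y | exists2 q, Q q & set_val y = q (set_val x)].

Definition same_orbit (x y : ball_space) : bool :=
  `[< ball_orbit x = ball_orbit y >].

Let same_orbit_refl : reflexive same_orbit. Proof. by move=> x; apply/asboolP. Qed.

Let same_orbit_sym : symmetric same_orbit.
Proof. by move=> x y; apply/asboolP/asboolP => ->. Qed.

Let same_orbit_trans : transitive same_orbit.
Proof. by move=> y x z /asboolP xy /asboolP yz; apply/asboolP; rewrite xy. Qed.

Canonical same_orbit_equiv :=
  EquivRel same_orbit same_orbit_refl same_orbit_sym same_orbit_trans.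

Definition orbit_space : topologicalType :=
  quotient_topology {eq_quot same_orbit}%qT.

End OrbitSpace.

(* Main.v *)
Require Import Defs.
From HB Require Import structures.
From mathcomp Require Import all_boot all_order all_algebra.
From mathcomp Require Import sesquilinear generic_quotient.
From mathcomp Require Import all_classical all_reals all_analysis.
From mathcomp Require Import ring lra.

Set Implicit Arguments.
Unset Strict Implicit.
Unset Printing Implicit Defensive.

Import Order.TTheory GRing.Theory Num.Theory.
Import numFieldNormedType.Exports.

Local Open Scope classical_set_scope.
Local Open Scope ring_scope.

(* (i) <-> (ii): every [x] in the unit ball is, up to a [d_R]-error [e], a
   multiple [c (+- r_1 +- ... +- r_m)] with [c = e / M ^ 2] and [m] bounded in
   terms of [e]: as long as some [r] in [R] has [|<r, x>| >= e], subtracting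
   [+- c r] decreases the squared norm of [x] by a fixed amount.

   (ii) -> (iv): an ultrafilter on the orbit space selects, for each [n], an
   orbit within [2 ^ - n]; representatives of these orbits can be chosen so that
   they form a [d_R]-Cauchy sequence [w]. The sets
   [{h in B(H) | d_R(w_n, h) <= 2 * 2 ^ - n}] are closed, convex and decreasing,
   so they have a common point, whose orbit is a limit of the ultrafilter.

   (iv) -> (iii): cover [B(H)] by the sets of points at [d_R]-distance less than
   [b z] from the translates of the [a]-ball around [z], where [z] is in [B(X)]
   and [b z] is small in terms of [f z]. A finite subcover gives [Z] such that
   [x - z^pi = u + v] with [|<r, u>| < b z] on [R] and [||v|| < a]; the terms
   [<r_i, v>] are then controlled by the inequalities of Bessel and Hoelder.

   (iii) -> (ii): take [f = 1] and [t = 1]. *)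

(** * Inner products and signed sums *)

Section InnerProductTheory.
Context {K : realType} {V : lmodType K} (dot : {dot V for @idfun K}).

Lemma dotC (u v : V) : dot u v = dot v u.
Proof. by rewrite hermC /= expr0 mul1r. Qed.

Lemma dotZr a (u v : V) : dot u (a *: v) = a * dot u v.
Proof. by rewrite linearZr_LR. Qed.

Lemma dotZl a (u v : V) : dot (a *: u) v = a * dot u v.
Proof. by rewrite dotC dotZr dotC. Qed.

Lemma dot0l (u : V) : dot 0 u = 0.
Proof. by rewrite dotC linear0r. Qed.

Lemma dot_ge0 (u : V) : 0 <= dot u u.
Proof.
have [->|u0] := eqVneq u 0; first by rewrite linear0r.
exact/ltW/neq0_dnorm_gt0.
Qed.

Lemma dot_eq0 (u : V) : dot u u = 0 -> u = 0.
Proof.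
move=> uu; apply: contra_eq uu => u0.
by rewrite gt_eqF// neq0_dnorm_gt0.
Qed.

Lemma dot_norm_ge0 (u : V) : 0 <= dot_norm dot u.
Proof. exact: sqrtr_ge0. Qed.

Lemma sqr_dot_norm (u : V) : dot_norm dot u ^+ 2 = dot u u.
Proof. exact/sqr_sqrtr/dot_ge0. Qed.

Lemma dotDD (u v : V) : dot (u + v) (u + v) = dot u u + 2 * dot u v + dot v v.
Proof. by rewrite !linearDr !linearDl/= (dotC v u); ring. Qed.

Lemma dotBB (u v : V) : dot (u - v) (u - v) = dot u u - 2 * dot u v + dot v v.
Proof. by rewrite dotDD -scaleN1r !dotZr dotZl; ring. Qed.

Lemma cauchy_schwarz (u v : V) : `|dot u v| <= dot_norm dot u * dot_norm dot v.
Proof.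
rewrite -ler_sqr ?nnegrE ?mulr_ge0 ?dot_norm_ge0// exprMn !sqr_dot_norm.
rewrite real_normK ?num_real//.
have [->|u0] := eqVneq u 0; first by rewrite !dot0l expr0n/= mul0r.
have uu : 0 < dot u u by exact: neq0_dnorm_gt0.
(* This vector is [dot u u] times the residual of projecting [v] on [u]. *)
have := dot_ge0 (dot u u *: v - dot u v *: u).
rewrite dotBB !dotZl !dotZr (dotC v u).
have -> : dot u u * (dot u u * dot v v) -
   2 * (dot u u * (dot u v * dot u v)) + dot u v * (dot u v * dot u u)
   = dot u u * (dot u u * dot v v - dot u v ^+ 2) by ring.
by rewrite pmulr_rge0// subr_ge0.
Qed.

Lemma polarization (u v : V) :
  dot u v = (dot_norm dot (u + v) ^+ 2 - dot_norm dot (u - v) ^+ 2) / 4.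
Proof. by rewrite !sqr_dot_norm dotDD dotBB; field. Qed.

Lemma dot_normZ a (u : V) : dot_norm dot (a *: u) = `|a| * dot_norm dot u.
Proof.
by rewrite /dot_norm dotZl dotZr mulrA sqrtrM ?sqr_ge0// -expr2 sqrtr_sqr.
Qed.

(** [s] is the projection of [v] onto the span of the [r i], and the claim is
    [0 <= dot (v - s) (v - s)]. A zero [r i] contributes a division by 0, which is 0. *)
Lemma bessel n (r : 'I_n -> V) (v : V) : pairwise_orthogonal_family dot r ->
  \sum_(i < n) dot (r i) v ^+ 2 / dot (r i) (r i) <= dot v v.
Proof.
move=> orth; pose c i := dot (r i) v / dot (r i) (r i).
pose s := \sum_(i < n) c i *: r i.
have rs i : dot (r i) s = c i * dot (r i) (r i).
  rewrite /s linear_sumr (bigD1 i)//= dotZr big1 ?addr0// => j ji.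
  by rewrite dotZr orth ?mulr0// eq_sym.
have sv : dot s v = \sum_(i < n) dot (r i) v ^+ 2 / dot (r i) (r i).
  rewrite /s linear_sumlz; apply: eq_bigr => i _.
  by rewrite /= dotZl /c expr2 mulrAC.
have ss : dot s s = dot s v.
  rewrite {1}/s sv linear_sumlz; apply: eq_bigr => i _.
  rewrite /= dotZl rs /c.
  have [->|r0] := eqVneq (dot (r i) (r i)) 0; first by rewrite invr0 !mulr0.
  by field.
have := dot_ge0 (v - s); rewrite dotBB (dotC v) ss -sv; lra.
Qed.

End InnerProductTheory.

(** * Vectors pairing weakly with a set *)

Section SmallElements.
Context {K : realType} {V : lmodType K} (dot : {dot V for @idfun K}).
Variable A : set V.

(** Pointwise form of a [d_A]-ball. It follows from [d_sup < e] but gives back only [d_sup <= e],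
    hence the larger radius in [small_ball]. *)
Definition small (e : K) (u : V) := forall r, A r -> `|dot r u| < e.

Lemma smallD e1 e2 u v : small e1 u -> small e2 v -> small (e1 + e2) (u + v).
Proof.
move=> su sv r Ar; rewrite linearDr (le_lt_trans (ler_normD _ _))//.
by apply: ltrD; [exact: su|exact: sv].
Qed.

Lemma smallN e u : small e (- u) <-> small e u.
Proof. by split=> su r Ar; have := su r Ar; rewrite linearNr normrN. Qed.

Lemma smallW e1 e2 u : e1 <= e2 -> small e1 u -> small e2 u.
Proof. by move=> e12 su r Ar; exact: lt_le_trans (su r Ar) e12. Qed.

Lemma small0 e : 0 < e -> small e 0.
Proof. by move=> e0 r _; rewrite linear0r normr0. Qed.

Lemma smallZ e c u : 0 < c -> small e u -> small (c * e) (c *: u).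
Proof.
move=> c0 su r Ar; rewrite dotZr normrM gtr0_norm// ltr_pM2l//; exact: su.
Qed.

Lemma small_sub_ball (x y : d_space dot A) e :
  ball x e y -> small e (x - y : V).
Proof.
move=> xy r Ar; rewrite -lte_fin; apply: le_lt_trans xy.
by apply: ereal_sup_ubound; exists r.
Qed.

Lemma small_ball (x y : d_space dot A) e e' :
  e < e' -> small e (x - y : V) -> ball x e' y.
Proof.
move=> ee' xy; apply: (@le_lt_trans _ _ e%:E); last by rewrite lte_fin.
by apply: ge_ereal_sup => _ [r Ar <-]; rewrite lee_fin; exact/ltW/xy.
Qed.

End SmallElements.

Section SignedSums.
Context {K : realType} {V : lmodType K} (dot : {dot V for @idfun K}).
Variables (R : set V) (M : K).
Hypotheses (M1 : 1 <= M) (RM : forall r, R r -> dot_norm dot r <= M).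

Lemma signed_sums0 (x : V) : signed_sums R 0 x <-> x = 0.
Proof.
split; first by move=> [s [r [_ ->]]]; rewrite big_ord0.
move=> ->; exists (fun=> false), (fun=> 0); split; first by case.
by rewrite big_ord0.
Qed.

Lemma signed_sumsS k x r (b : bool) : R r -> signed_sums R k x ->
  signed_sums R k.+1 ((-1) ^+ b *: r + x).
Proof.
move=> Rr [s [f [Rf ->]]].
exists (fun i => if unlift ord0 i is Some j then s j else b).
exists (fun i => if unlift ord0 i is Some j then f j else r); split.
  by move=> i; case: unliftP.
rewrite big_ord_recl unlift_none; congr (_ + _).
by apply: eq_bigr => i _; rewrite liftK.
Qed.

Lemma signed_sums_norm k x : signed_sums R k x -> dot x x <= (k%:R * M) ^+ 2.
Proof.
move=> [s [f [Rf ->]]].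
have -> : (k%:R * M) ^+ 2 = \sum_(i < k) \sum_(j < k) M ^+ 2.
  by rewrite !sumr_const !card_ord -mulrnA -[RHS]mulr_natl natrM; ring.
rewrite linear_sumlz; apply: ler_sum => i _.
rewrite linear_sumr; apply: ler_sum => j _ /=.
rewrite dotZl dotZr (le_trans (ler_norm _))// !normrM !normrX normrN1 !expr1n !mul1r.
rewrite (le_trans (cauchy_schwarz _ _ _))// expr2.
by rewrite ler_pM ?dot_norm_ge0 ?RM.
Qed.

(* Subtracting the multiple [(e / M ^+ 2) r] of an [r] with [|<r, x>| >= e]
   decreases the squared norm of [x] by at least [(e / M) ^+ 2]. *)
Lemma signed_sums_approx (e : K) n x : 0 < e -> dot x x <= n%:R * (e / M) ^+ 2 ->
  exists m s, [/\ (m <= n)%N, signed_sums R m s &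
    small dot R e (x - (e / M ^+ 2) *: s)].
Proof.
move=> e0; have M0 : 0 < M by exact: lt_le_trans ltr01 M1.
(* [n] bounds the number of decrements of size [(e / M) ^+ 2] that [dot x x] allows. *)
elim: n x => [|n IH] x xn.
  exists 0%N, 0; split => //; first exact/signed_sums0.
  rewrite scaler0 subr0; have -> : x = 0.
    apply: (@dot_eq0 _ _ dot); apply/eqP; rewrite eq_le dot_ge0 andbT.
    by rewrite (le_trans xn)// mul0r.
  exact: small0.
have [xs|] := pselect (small dot R e x).
  exists 0%N, 0; split => //; first exact/signed_sums0.
  by rewrite scaler0 subr0.
move=> /existsNP[r /not_implyP[Rr /negP]]; rewrite -leNgt => exr.
pose b := (dot r x < 0); pose c := e / M ^+ 2.
have c0 : 0 < c by rewrite divr_gt0// exprn_gt0.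
have brx : (-1) ^+ b * dot r x = `|dot r x|.
  rewrite /b; have [h|h] := ltP (dot r x) 0.
    by rewrite expr1 mulN1r ltr0_norm.
  by rewrite expr0 mul1r ger0_norm.
have rr : dot r r <= M ^+ 2.
  by rewrite -sqr_dot_norm lerXn2r ?nnegrE ?dot_norm_ge0 ?RM// ltW.
have [|m [s [mn ss sm]]] := IH (x - c *: ((-1) ^+ b *: r)).
  have -> : dot (x - c *: ((-1) ^+ b *: r)) (x - c *: ((-1) ^+ b *: r)) =
      dot x x - 2 * (c * `|dot r x|) + c * (c * dot r r).
    rewrite dotBB !dotZr !dotZl. rewrite (dotC dot x r) brx.
    by congr (_ + c * _); rewrite mulrCA signrMK.
  (* As [c * M ^+ 2 = e], the squared norm changes by at most
     [- 2 * c * e + c * e = - (e / M) ^+ 2]. *)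
  have h1 : c * e <= c * `|dot r x| by rewrite ler_pM2l.
  have h2 : c * (c * dot r r) <= c * e.
    rewrite ler_pM2l// (le_trans (ler_wpM2l (ltW c0) rr))//.
    by rewrite /c divfK// expf_neq0// gt_eqF.
  have -> : n%:R * (e / M) ^+ 2 = n.+1%:R * (e / M) ^+ 2 - c * e.
    by rewrite -natr1 /c; field; rewrite gt_eqF.
  by lra.
exists m.+1, ((-1) ^+ b *: r + s); split => //; first exact: signed_sumsS.
by rewrite scalerDr opprD addrA.
Qed.

End SignedSums.

(** * Nets modulo the group *)

Section OrbitNets.
Context {K : realType} {X : lmodType K} (dotX : {dot X for @idfun K}).
Variables (R : set X) (G : set {linear X -> X}).
Hypothesis G_group : orthogonal_group dotX G.
Hypothesis G_R : forall p : {linear X -> X}, G p -> p @` R = R.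

Definition orbit_net (Z B : set X) (e : K) := forall x, B x ->
  exists (z : X) (p : {linear X -> X}), Z z /\ G p /\ small dotX R e (x - p z).

Lemma small_orthogonal p e u : G p -> small dotX R e (p u) <-> small dotX R e u.
Proof.
move=> Gp; have iso := orthogonal_group_isometry G_group Gp.
split=> su r Rr.
  by rewrite -iso; apply: su; rewrite -(G_R Gp); exists r.
by move: Rr; rewrite -{1}(G_R Gp) => -[r' Rr' <-]; rewrite iso; exact: su.
Qed.

Lemma orthogonal_unit_ball p x :
  G p -> dot_unit_ball dotX x -> dot_unit_ball dotX (p x).
Proof.
by move=> Gp; rewrite /dot_unit_ball/= /dot_norm (orthogonal_group_isometry G_group Gp).
Qed.

(* The net is moved into [B] by replacing each of its points by a point of [B]
   that it approximates. *)
Lemma orbit_net_sub (Z B : set X) e : finite_set Z -> orbit_net Z B e ->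
  exists Z', [/\ finite_set Z', Z' `<=` B & orbit_net Z' B (e + e)].
Proof.
move=> finZ netZ; pose close z b :=
  B b /\ exists2 p : {linear X -> X}, G p & small dotX R e (b - p z).
have [g gP] : {g : X -> X & forall z, (exists b, close z b) -> close z (g z)}.
  apply: (@choice _ _ (fun z b => (exists b', close z b') -> close z b)) => z.
  have [[b zb]|nb] := pselect (exists b, close z b).
    by exists b.
  by exists 0 => b; case: nb.
exists (g @` (Z `&` [set z | exists b, close z b])); split.
- by apply: finite_image; exact: finite_setIl.
- by move=> _ [z [Zz /gP[]] Bgz _ <-].
- move=> x Bx; have [z [p [Zz [Gp xpz]]]] := netZ _ Bx.
  have zx : exists b, close z b by exists x; split => //; exists p.
  have [Bg [q Gq gqz]] := gP _ zx.
  have [q' Gq' [qK _]] := orthogonal_groupV G_group Gq.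
  exists (g z), (p \o q'); split; first by exists z.
  split; first exact: (orthogonal_groupM G_group).
  (* [g z] is near [q z], hence [q' (g z)] is near [z]; this second error doubles [e]. *)
  have -> : x - (p \o q') (g z) = (x - p z) + p (q' (q z - g z)).
    by rewrite /= !linearB qK addrA subrK.
  apply: smallD => //; apply/(small_orthogonal _ _ Gp).
  by apply/(small_orthogonal _ _ Gq'); rewrite -smallN opprB.
Qed.

Variable M : K.
Hypotheses (M1 : 1 <= M) (RM : forall r, R r -> dot_norm dotX r <= M).

Lemma signed_sums_net_ball :
  (forall k, (0 < k)%N -> exists2 Z : set X, finite_set Z &
     forall x, signed_sums R k x ->
       exists (z : X) (p : {linear X -> X}), Z z /\ G p /\
         forall r, R r -> dotX r (x - p z) ^+ 2 <= 1) ->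
  forall e, 0 < e -> exists Z : set X, finite_set Z /\
    Z `<=` dot_unit_ball dotX /\ orbit_net Z (dot_unit_ball dotX) e.
Proof.
move=> net e e0; have M0 : 0 < M by exact: lt_le_trans ltr01 M1.
(* The approximation may stop at the empty sum, so [k = 0] is added; 2 replaces the bound 1 to make
   it strict. *)
have {}net k : exists Z : set X, finite_set Z /\ orbit_net Z (signed_sums R k) 2.
  case: k => [|k].
    exists [set 0]; split; first exact: finite_set1.
    move=> x /signed_sums0 ->; exists 0, idfun; split => //; split.
      exact: orthogonal_group1 G_group.
    by rewrite subrr; exact: small0.
  have [//|Z finZ ZP] := net k.+1; exists Z; split => // x /ZP[z [p [Zz [Gp zp]]]].
  exists z, p; split => //; split => // r Rr; apply: (@le_lt_trans _ _ 1).
    by rewrite -ler_sqr ?nnegrE// real_normK ?num_real// expr1n; exact: zp.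
  by rewrite ltr1n.
have [Z ZP] := choice net.
(* The error will be [d + c * 2 <= 3 * d], which [orbit_net_sub] doubles to at most [6 * d = e]. *)
pose d := e / 6; have d0 : 0 < d by rewrite divr_gt0.
have [N Nd] : exists N : nat, 1 <= N%:R * (d / M) ^+ 2.
  exists (Num.truncn ((d / M) ^- 2)).+1.
  have dM : 0 < (d / M) ^+ 2 by rewrite exprn_gt0// divr_gt0.
  by rewrite -ler_pdivrMr// div1r ltW// truncnS_gt.
pose c := d / M ^+ 2; have c0 : 0 < c by rewrite divr_gt0// exprn_gt0.
have cd : c <= d by rewrite ler_pdivrMr ?exprn_gt0// ler_peMr ?(ltW d0)// exprn_ege1.
pose Z' := \bigcup_(m in `I_N.+1) (fun z => c *: z) @` Z m.
have finZ' : finite_set Z'.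
  by apply: bigcup_finite => // m _; apply: finite_image; exact: (ZP m).1.
have net' : orbit_net Z' (dot_unit_ball dotX) (d + c * 2).
  move=> x xB; have [|m [s [mN sm xs]]] := signed_sums_approx M1 RM (n := N) d0 (x := x).
    rewrite (le_trans _ Nd)// -sqr_dot_norm exprn_ile1//; exact: dot_norm_ge0.
  have [z [p [Zz [Gp spz]]]] := (ZP m).2 s sm.
  exists (c *: z), p; split; first by exists m => //; exists z.
  split => //.
  have -> : x - p (c *: z) = (x - c *: s) + c *: (s - p z).
    by rewrite linearZ scalerBr addrA subrK.
  by apply: smallD => //; exact: smallZ.
have [Z2 [finZ2 Z2B netZ2]] := orbit_net_sub finZ' net'.
exists Z2; split => //; split => // x /netZ2[z [p [Zz [Gp xz]]]].
exists z, p; split => //; split => //; apply: smallW xz.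
by rewrite /d in cd *; lra.
Qed.

(** Sums of [k] terms have norm at most [c], so a net of precision [c^-1] for the unit ball, scaled
    by [c], has precision 1. *)
Lemma ball_net_signed_sums :
  (forall e, 0 < e -> exists Z : set X, finite_set Z /\
    Z `<=` dot_unit_ball dotX /\ orbit_net Z (dot_unit_ball dotX) e) ->
  forall k, (0 < k)%N -> exists2 Z : set X, finite_set Z &
     forall x, signed_sums R k x ->
       exists (z : X) (p : {linear X -> X}), Z z /\ G p /\
         forall r, R r -> dotX r (x - p z) ^+ 2 <= 1.
Proof.
move=> net k k0; pose c := k%:R * M.
have c0 : 0 < c by rewrite mulr_gt0 ?ltr0n// (lt_le_trans ltr01 M1).
have [|Z [finZ [_ netZ]]] := net c^-1; first by rewrite invr_gt0.
exists ((fun z => c *: z) @` Z); first exact: finite_image.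
move=> x xk; have [|z [p [Zz [Gp sz]]]] := netZ (c^-1 *: x).
  rewrite /dot_unit_ball/= dot_normZ gtr0_norm ?invr_gt0// ler_pdivrMl// mulr1.
  rewrite -ler_sqr ?nnegrE ?dot_norm_ge0 ?(ltW c0)// sqr_dot_norm.
  exact: (signed_sums_norm RM).
exists (c *: z), p; split; first by exists z.
split => // r Rr.
have -> : x - p (c *: z) = c *: (c^-1 *: x - p z).
  by rewrite linearZ scalerBr scalerA divff ?scale1r// gt_eqF.
have := smallZ c0 sz Rr; rewrite divff ?gt_eqF// => /ltW h.
by rewrite -[_ ^+ 2]real_normK ?num_real// exprn_ile1.
Qed.

End OrbitNets.

(** * Bessel and Hoelder *)

Section Hoelder.
Context {K : realType}.

Lemma lp_norm_div2B n (t : K) (v : 'I_n -> K) : t < 2 ->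
  lp_norm (2%:E / (2 - t)%:E)%E v =
  (\sum_(i < n) `|v i| `^ (1 - t / 2)^-1) `^ (1 - t / 2).
Proof.
move=> t2; have t20 : 2 - t != 0 by rewrite gt_eqF// subr_gt0.
have -> : (2%:E / (2 - t)%:E = ((1 - t / 2)^-1)%:E :> \bar K)%E.
  by rewrite inver (negbTE t20) -EFinM; congr _%:E; field; rewrite t20/=; lra.
by rewrite /lp_norm invrK.
Qed.

(** Hoelder's inequality with exponents [s^-1] and [(1 - s)^-1]. A positive bound [A] in place of
    the sum of the [a i] avoids the case where that sum vanishes. *)
Lemma hoelder_sum n (a b : 'I_n -> K) (s A : K) : 0 < s -> s < 1 ->
  (forall i, 0 <= a i) -> (forall i, 0 <= b i) -> 0 < A -> \sum_i a i <= A ->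
  \sum_i a i `^ s * b i <= A `^ s * (\sum_i b i `^ (1 - s)^-1) `^ (1 - s).
Proof.
move=> s0 s1 a0 b0 A0 aA; have s1' : 0 < 1 - s by lra.
set q := (1 - s)^-1; have q0 : 0 < q by rewrite invr_gt0.
have qn : q != 0 by rewrite gt_eqF.
set S := \sum_i b i `^ q; have S0 : 0 <= S by apply: sumr_ge0 => i _; exact: powR_ge0.
have [SE|Sn] := eqVneq S 0.
  rewrite SE powR0 ?gt_eqF// mulr0 big1// => i _.
  have /eqP : b i `^ q = 0.
    by apply: (psumr_eq0P _ SE) => // j _; exact: powR_ge0.
  by rewrite powR_eq0 => /andP[/eqP -> _]; rewrite mulr0.
have {Sn}S0 : 0 < S by rewrite lt_def Sn.
have AsS0 : 0 < A `^ s * S `^ (1 - s) by rewrite mulr_gt0 ?powR_gt0.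
(* Young's inequality for the normalised terms; the right-hand sides sum to at most
   [s + (1 - s) = 1]. *)
suff young i : a i `^ s * b i / (A `^ s * S `^ (1 - s)) <=
    s * (a i / A) + (1 - s) * (b i `^ q / S).
  rewrite -[leRHS]mul1r -ler_pdivrMr// mulr_suml (le_trans (ler_sum _ (fun i _ => young i)))//.
  rewrite big_split/= -!mulr_sumr -!mulr_suml -/S divff ?gt_eqF//.
  have : (\sum_i a i) / A <= 1 by rewrite ler_pdivrMr// mul1r.
  by move=> h; have := ler_wpM2l (ltW s0) h; lra.
have aA0 : 0 <= a i / A by rewrite divr_ge0// ltW.
have := @conjugate_powR _ ((a i / A) `^ s) (b i / S `^ (1 - s)) s^-1 q
  (powR_ge0 _ _) (divr_ge0 (b0 i) (powR_ge0 _ _)).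
rewrite invr_gt0 s0 q0 /q !invrK addrC subrK => /(_ isT isT erefl).
rewrite -powRrM divff ?gt_eqF// powRr1// -/q.
have -> : (b i / S `^ (1 - s)) `^ q = b i `^ q / S.
  rewrite powRM ?invr_ge0 ?powR_ge0// -powRN -powRrM mulNr mulfV ?gt_eqF//.
  by rewrite powR_inv1// ltW.
have -> : (a i / A) `^ s = a i `^ s / A `^ s.
  rewrite powRM ?invr_ge0 ?(ltW A0)//; congr (_ * _).
  by rewrite -powR_inv1 ?(ltW A0)// -powRrM mulN1r powRN.
by rewrite (mulrC s) (mulrC (1 - s)) mulrACA -invfM.
Qed.

(** Each term is the Bessel quotient [a i] to the power [t / 2] times the norm of [r i] to the power
    [t]; Hoelder applies with exponents [2 / t] and [2 / (2 - t)]. *)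
Lemma hoelder_bessel (V : lmodType K) (dot : {dot V for @idfun K}) n
    (r : 'I_n -> V) (v : V) (d t : K) :
  pairwise_orthogonal_family dot r -> 0 < t -> t <= 2 -> 0 < d ->
  dot v v <= d ^+ 2 ->
  \sum_i `|dot (r i) v| `^ t <=
  d `^ t * lp_norm (2%:E / (2 - t)%:E)%E (fun i => dot_norm dot (r i) `^ t).
Proof.
move=> orth t0 t2 d0 vd.
pose a i := dot (r i) v ^+ 2 / dot (r i) (r i); pose b i := dot_norm dot (r i) `^ t.
have a0 i : 0 <= a i by rewrite divr_ge0 ?sqr_ge0 ?dot_ge0.
have b0 i : 0 <= b i by exact: powR_ge0.
have ad : \sum_i a i <= d ^+ 2 by rewrite (le_trans (bessel v orth)).
have powR_sqr (x : K) : 0 <= x -> (x ^+ 2) `^ (t / 2) = x `^ t.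
  by move=> x0; rewrite -powR_mulrn// -powRrM mulrC divfK.
have -> : \sum_i `|dot (r i) v| `^ t = \sum_i a i `^ (t / 2) * b i.
  apply: eq_bigr => i _; rewrite -powR_sqr// real_normK ?num_real//.
  rewrite /b -powR_sqr ?dot_norm_ge0// sqr_dot_norm /a.
  rewrite -powRM ?divr_ge0 ?sqr_ge0 ?dot_ge0//.
  have [rr|rr] := eqVneq (dot (r i) (r i)) 0; last by rewrite divfK.
  by rewrite (dot_eq0 rr) !dot0l expr0n/= !mul0r.
(* At [t = 2] the exponent is [2 / 0 = +oo], and each [b i] is bounded by the maximum. *)
rewrite -(powR_sqr d (ltW d0)); have [t2E|t2N] := eqVneq t 2.
  rewrite {1 2 3}t2E divff// powRr1 ?sqr_ge0// subrr inver eqxx gt0_muley ?lte_fin//.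
  apply: (@le_trans _ _ (\sum_i a i * \big[Num.max/0]_i `|b i|)).

    apply: ler_sum => i _; rewrite powRr1// ler_wpM2l//.
    by rewrite -[b i in X in X <= _]ger0_norm// (le_bigmax 0 (fun i => `|b i|)).
  rewrite -mulr_suml. rewrite ler_wpM2r//.
  exact: bigmax_ge_id.
have {t2 t2N}t2 : t < 2 by rewrite lt_neqAle t2N.
rewrite lp_norm_div2B// -/b.
rewrite [in leRHS](eq_bigr (fun i => b i `^ (1 - t / 2)^-1)); last first.
  by move=> i _; rewrite (ger0_norm (b0 i)).
by apply: hoelder_sum; rewrite ?divr_gt0 ?ltr_pdivrMr ?mul1r ?exprn_gt0.
Qed.

End Hoelder.

(** * Nested convex sets in a Hilbert space *)

Section HilbertSpace.
Context {K : realType} {H : completeNormedModType K}.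
Variable dotH : {dot H for @idfun K}.
Hypothesis normE : forall h : H, `|h| = dot_norm dotH h.

Lemma dot_continuous (r : H) : continuous (dotH r : H -> K).
Proof.
have -> : (dotH r : H -> K) =
    (fun y => (`|r + y| * `|r + y| - `|r - y| * `|r - y|) / 4).
  by apply/funext => y; rewrite (polarization dotH) !normE !expr2.
move=> y.
have cD : `|r + x| @[x --> y] --> `|r + y|.
  by apply: cvg_norm; apply: cvgD; [exact: cvg_cst|exact: cvg_id].
have cB : `|r - x| @[x --> y] --> `|r - y|.
  by apply: cvg_norm; apply: cvgB; [exact: cvg_cst|exact: cvg_id].
by apply: cvgMl; apply: cvgB; apply: cvgM.
Qed.

(** The sum enters as a midpoint: a convex set contains it, which bounds its norm from below. *)
Lemma parallelogram (u v : H) :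
  `|u - v| ^+ 2 = 2 * `|u| ^+ 2 + 2 * `|v| ^+ 2 - 4 * `|2^-1 *: (u + v)| ^+ 2.
Proof.
rewrite !normE dot_normZ exprMn !sqr_dot_norm dotBB dotDD.
by rewrite ger0_norm ?invr_ge0//; field.
Qed.

(* Elements of [C n] of almost minimal norm form a Cauchy sequence, by the
   parallelogram identity. *)
Lemma nested_convex_bigcap (C : nat -> set H) (M : K) :
  (forall n, closed (C n)) ->
  (forall n u v, C n u -> C n v -> C n (2^-1 *: (u + v))) ->
  (forall n, C n.+1 `<=` C n) -> (forall n, C n !=set0) ->
  (forall u, C 0%N u -> `|u| <= M) ->
  exists h, forall n, C n h.
Proof.
move=> Ccl Ccvx CS Cn0 CM.
have Cle m n : (m <= n)%N -> C n `<=` C m.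
  move=> /subnKC <-; elim: (n - m)%N => [|d IH]; first by rewrite addn0.
  by rewrite addnS; exact: subset_trans (CS _) IH.
pose N n := [set `|u| ^+ 2 | u in C n].
have Nlb n : has_lbound (N n).
  by exists 0 => _ [u _ <-]; exact: sqr_ge0.
have Ninf n : has_inf (N n).
  by split => //; have [u Cu] := Cn0 n; exists (`|u| ^+ 2), u.
pose m n := inf (N n).
have mP n u : C n u -> m n <= `|u| ^+ 2 by move=> Cu; apply: ge_inf => //; exists u.
have eps_gt0 n : 0 < 2^-1 ^+ n :> K by rewrite exprn_gt0.
have near_min n : exists u, C n u /\ `|u| ^+ 2 < m n + 2^-1 ^+ n.
  by have [_ [u Cu <-] ?] := inf_adherent (eps_gt0 n) (Ninf n); exists u.
have [y yP] := choice near_min.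
have mM n : m n <= M ^+ 2.
  have [u Cu] := Cn0 n; rewrite (le_trans (mP _ _ Cu))//.
  have uM : `|u| <= M by apply: CM; exact: Cle Cu.
  by rewrite lerXn2r ?nnegrE// (le_trans _ uM).
have mS : has_sup (range m).
  by split; [exists (m 0%N), 0%N|exists (M ^+ 2) => _ [n _ <-]].
pose S := sup (range m).
(* The midpoint lies in [C n], so the identity leaves [2 * (m k - m n)] plus the errors, and
   [m k <= S]. *)
have ym n k : (n <= k)%N -> `|y n - y k| ^+ 2 <= 2 * (S - m n) + 4 * 2^-1 ^+ n.
  move=> nk; rewrite parallelogram.
  have [[Cyn yn] [Cyk yk]] := (yP n, yP k).
  have mid : m n <= `|2^-1 *: (y n + y k)| ^+ 2.
    by apply: mP; apply: Ccvx => //; exact: Cle Cyk.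
  have mkS : m k <= S by apply: ub_le_sup; [case: mS|exists k].
  have : 2^-1 ^+ k <= 2^-1 ^+ n :> K by rewrite ler_wiXn2l// invf_le1// ler1n.
  by move: (eps_gt0 k) (eps_gt0 n); lra.
have ycauchy : cauchy (y @ \oo).
  apply/cauchyP => e e0.
  (* In [ym] both [S - m n] and [2^-1 ^+ n] will be below [e ^+ 2 / 6], with coefficients 2 and
     4. *)
  have e20 : 0 < e ^+ 2 / 6 by rewrite divr_gt0// exprn_gt0.
  have [_ [n1 _ <-] mn1] := sup_adherent e20 mS.
  have /cvgrPdist_lt /(_ _ e20) [n2 _ n2P] : (2^-1 ^+ n : K) @[n --> \oo] --> (0 : K).
    by apply: cvg_expr; rewrite ger0_norm// invf_lt1// ltr1n.
  pose n := maxn n1 n2.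
  exists (y n), n => //= k /= nk; rewrite -ball_normE/=.
  rewrite -ltr_sqr ?nnegrE ?(ltW e0)// (le_lt_trans (ym _ _ nk))//.
  have mn : m n1 <= m n.
    apply: lb_le_inf; first by case: (Ninf n).
    by move=> _ [u Cu <-]; apply: mP; apply: Cle Cu; exact: leq_maxl.
  have := n2P n (leq_maxr _ _); rewrite /= sub0r normrN ger0_norm ?(ltW (eps_gt0 n))//.
  move: mn1 mn; rewrite -/S; lra.
have ylim : cvg (y @ \oo) by exact: cauchy_cvg.
exists (lim (y @ \oo)) => n; apply: (closed_cvg _ (Ccl n) _ _ ylim).
by exists n => // k /= nk; apply: (Cle _ _ nk); exact: (yP k).1.
Qed.

Lemma small_cauchy_limit (A : set H) (w : nat -> H) :
  (forall n, `|w n| <= 1) ->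
  (forall n, small dotH A (2^-1 ^+ n) (w n - w n.+1)) ->
  exists h, `|h| <= 1 /\ forall n r, A r -> `|dotH r (w n - h)| <= 2 * 2^-1 ^+ n.
Proof.
move=> w1 ww; pose C n := [set h : H | `|h| <= 1 /\
  forall r, A r -> `|dotH r (w n - h)| <= 2 * 2^-1 ^+ n].
suff [h hC] : exists h, forall n, C n h.
  by exists h; split; [have [] := hC 0%N|move=> n; have [] := hC n].
apply: (@nested_convex_bigcap _ 1).
- move=> n; rewrite (_ : C n = (fun h => `|h|) @^-1` [set x | x <= 1] `&`
      \bigcap_(r in A) (fun h => `|dotH r (w n - h)|) @^-1` [set x | x <= 2 * 2^-1 ^+ n]).
    apply: closedI.
      by apply: closed_comp; [move=> x _; exact: norm_continuous|exact: closed_le].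
    apply: closed_bigI => r _; apply: closed_comp; last exact: closed_le.
    move=> x _; apply: cvg_norm.
    apply: (@cvg_comp _ _ _ (fun h => w n - h) (dotH r) _ (nbhs (w n - x))).
      by apply: cvgB; [exact: cvg_cst|exact: cvg_id].
    exact: dot_continuous.
  by [].
- move=> n u v [u1 uw] [v1 vw]; split.
    rewrite normrZ ger0_norm ?invr_ge0// ler_pdivrMl// mulr1.
    by rewrite (le_trans (ler_normD _ _))// (natrD _ 1 1) lerD.
  move=> r Ar; have -> : w n - 2^-1 *: (u + v) = 2^-1 *: ((w n - u) + (w n - v)).
    rewrite addrACA -opprD scalerBr; congr (_ - _).
    by rewrite -mulr2n -[X in _ = _ *: X]scaler_nat scalerA mulVf ?scale1r ?pnatr_eq0.
  rewrite dotZr normrM ger0_norm ?invr_ge0// ler_pdivrMl// linearDr.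
  by rewrite (le_trans (ler_normD _ _))// [leRHS]mulr_natl mulr2n lerD ?uw ?vw.
(* The radius satisfies [2^-1 ^+ n + 2 * 2^-1 ^+ n.+1 = 2 * 2^-1 ^+ n], so the [C n] decrease. *)
- move=> n u [u1 uw]; split => // r Ar.
  have -> : w n - u = (w n - w n.+1) + (w n.+1 - u) by rewrite addrA subrK.
  rewrite linearDr (le_trans (ler_normD _ _))//.
  have := uw r Ar; have := ww n r Ar; rewrite exprS mulrA divff ?pnatr_eq0// mul1r.
  lra.
- move=> n; exists (w n); split => // r _.
  by rewrite subrr linear0r normr0 mulr_ge0// exprn_ge0.
- by move=> u [].
Qed.

End HilbertSpace.

(** * The orbit space *)

(** Near-covering compactness is applied to index sets ordered by inclusion: once such a set
    contains [i], it covers [f i]. *)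
Lemma compact_finite_cover (T : topologicalType) (I : Type) (f : I -> set T) :
  compact [set: T] -> (forall x : T, exists i, nbhs x (f i)) ->
  exists2 Z : set I, finite_set Z & forall x, exists2 i, Z i & f i x.
Proof.
move=> /compact_near_coveringP cT fx.
pose above (Z0 : set I) := [set Z | Z0 `<=` Z].
pose F := filter_from (@finite_set I) above.
have FF : Filter F.
  apply: filter_from_filter; first by exists set0; exact: finite_set0.
  move=> A B finA finB; exists (A `|` B); first by rewrite finite_setU.
  by move=> Z ABZ; split=> i Zi; apply: ABZ; [left|right].
have [|Z finZ ZP] := cT _ F (fun Z x => exists2 i, Z i & f i x) FF.
  move=> x _; have [i xi] := fx x.
  exists (f i, above [set i]) => /=.
    by split => //; exists [set i] => //; exact: finite_set1.
  by move=> [y Z] /= [fy iZ]; exists i => //; exact: iZ.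
by exists Z => // x; exact: (ZP Z).
Qed.

(** Otherwise all complements, hence their finite intersection, would belong to [F], and that
    intersection is empty. *)
Lemma ultra_finite_cover (T : Type) (I : choiceType) (F : set_system T)
    (Z : set I) (W : I -> set T) : UltraFilter F -> finite_set Z ->
  (forall x, exists2 i, Z i & W i x) -> exists2 i, Z i & F (W i).
Proof.
move=> FU /finite_seqP[s ->] ZW; apply: contrapT => noi.
have /filter_ex[x xP] : F [set x | forall i, i \in s -> ~ W i x].
  have : forall i, i \in s -> F (~` W i).
    move=> i si; have [FW|//] := in_ultra_setVsetC (W i) FU.
    by case: noi; exists i.
  elim: s {ZW noi} => [|j s IH] sW; first by apply: filterS filterT.
  have FI : F [set x | forall i, i \in s -> ~ W i x].
    by apply: IH => i si; apply: sW; rewrite inE si orbT.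
  apply: filterS (filterI (sW j (mem_head _ _)) FI) => x [Wj Ws] i.
  by rewrite inE => /predU1P[->|/Ws].
by have [i si Wi] := ZW x; exact: xP Wi.
Qed.

(** * Extension of the group to the completion *)

Section OrbitSpaceTheory.
Context {K : realType} {X : lmodType K} (dotX : {dot X for @idfun K}).
Variables (R : set X) (G : set {linear X -> X}).
Hypothesis G_group : orthogonal_group dotX G.
Hypothesis G_R : forall p : {linear X -> X}, G p -> p @` R = R.
Context {H : completeNormedModType K} (dotH : {dot H for @idfun K}).
Variable iota : {linear X -> H}.
Hypothesis H_completion : hilbert_completion dotX dotH iota.

Let normE (h : H) : `|h| = dot_norm dotH h.
Proof. exact: (hilbert_completion_norm H_completion). Qed.

Let iotaP u v : dotH (iota u) (iota v) = dotX u v.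
Proof. exact: (hilbert_completion_isometry H_completion). Qed.

Lemma completion_norm x : `|iota x| = dot_norm dotX x.
Proof. by rewrite normE /dot_norm iotaP. Qed.

Lemma completion_dense (h : H) (e : K) : 0 < e -> exists x, `|h - iota x| < e.
Proof.
move=> e0; have [] := hilbert_completion_dense H_completion (O := ball h e).
- by exists h; exact: ballxx.
- exact: ball_open.
- by move=> y [hy [x _ xy]]; exists x; move: hy; rewrite xy -ball_normE.
Qed.

(** An approximation in [X] may leave the unit ball; shrinking it by [c] brings it back at a cost of
    [e / 2]. *)
Lemma completion_dense_ball (h : H) (e : K) : `|h| <= 1 -> 0 < e ->
  exists2 x, dot_unit_ball dotX x & `|h - iota x| < e.
Proof.
move=> h1 e0; have e20 : 0 < e / 2 by rewrite divr_gt0.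
have [x hx] := completion_dense h e20; pose c := (1 + e / 2)^-1.
have c0 : 0 < c by rewrite invr_gt0 addr_gt0.
have x1 : `|iota x| <= 1 + e / 2.
  rewrite -[iota x](subrK h) (le_trans (ler_normD _ _))// addrC lerD//.
  by rewrite distrC ltW.
exists (c *: x).
  rewrite /dot_unit_ball/= -completion_norm linearZ normrZ gtr0_norm//.
  by rewrite ler_pdivrMl ?mulr1// addr_gt0.
have -> : h - iota (c *: x) = (h - iota x) + (1 - c) *: iota x.
  by rewrite linearZ scalerBl scale1r addrA subrK.
rewrite (le_lt_trans (ler_normD _ _))// [e]splitr ltr_leD// normrZ.
have c1 : 0 <= 1 - c by rewrite subr_ge0 invf_le1 ?addr_gt0// lerDl ltW.
rewrite ger0_norm// (le_trans (ler_wpM2l c1 x1))// mulrBl mul1r mulVf ?gt_eqF ?addr_gt0//.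
by rewrite addrC addKr.
Qed.

Lemma small_completion e u :
  small dotH (iota @` R) e (iota u) <-> small dotX R e u.
Proof.
split=> su r Rr; first by rewrite -iotaP; apply: su; exists r.
by case: Rr => r' Rr' <-; rewrite iotaP; exact: su.
Qed.

(* The maps [q] in [extended_group iota G] are handled through this relation,
   where [p] is the element of [G] extended by [q]. *)
Definition follows (q : H -> H) (p : {linear X -> X}) :=
  forall h x, `|q h - iota (p x)| = `|h - iota x|.

(** The equality of distances holds on the range of [iota] and is a closed condition on [h]. *)
Lemma extended_group_follows q : extended_group iota G q ->
  exists2 p, G p & follows q p.
Proof.
move=> [qc [p Gp qp]]; exists p => // h x.
pose C := [set h | `|q h - iota (p x)| - `|h - iota x| = 0].
have Cr y : C (iota y).
  rewrite /C/= qp -!linearB !completion_norm /dot_norm.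
  by rewrite (orthogonal_group_isometry G_group Gp) subrr.
have Ccl : closed C.
  apply: (@closed_comp _ _ (fun h => `|q h - iota (p x)| - `|h - iota x|) [set 0]).
    move=> y _; apply: cvgB; apply: cvg_norm; apply: cvgB; try exact: cvg_cst.
      exact: qc.
    exact: cvg_id.
  exact: closed_eq.
apply/eqP; rewrite -subr_eq0; apply/eqP; apply: (Ccl h) => B /nbhs_ballP[e /= e0 hB].
have [y hy] := completion_dense h e0; exists (iota y); split => //.
by apply: hB; rewrite -ball_normE.
Qed.

Lemma follows_extended_group q p : G p -> follows q p -> extended_group iota G q.
Proof.
move=> Gp qp; split; last first.
  by exists p => // x; apply/eqP; rewrite -subr_eq0 -normr_eq0 qp subrr normr0.
move=> h; apply/cvgrPdist_lt => e e0; have e20 : 0 < e / 2 by rewrite divr_gt0.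
have [x hx] := completion_dense h e20.
have : nbhs h (ball (iota x) (e / 2)).
  apply: open_nbhs_nbhs; split; first exact: ball_open.
  by rewrite -ball_normE/= distrC.
apply: filterS => y; rewrite -ball_normE/= => xy.
rewrite -(subrK (iota (p x)) (q h)) -addrA (le_lt_trans (ler_normD _ _))// [e]splitr.
by rewrite ltrD// ?qp// distrC qp distrC.
Qed.

Lemma follows_uniq (u v : H) : (forall x, `|u - iota x| = `|v - iota x|) -> u = v.
Proof.
move=> uv; apply/eqP; rewrite -subr_eq0 -normr_le0; apply/ler_addgt0Pr => e e0.
have e20 : 0 < e / 2 by rewrite divr_gt0.
have [x ux] := completion_dense u e20; rewrite add0r.
rewrite -(subrK (iota x) u) -addrA (le_trans (ler_normD _ _))// [e]splitr lerD ?ltW//.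
by rewrite distrC -uv.
Qed.

(** Extension by continuity: [iota (p (y n))] is Cauchy because [p] is isometric, and distances pass
    to the limit. *)
Lemma follows_exists p : G p -> exists q, follows q p.
Proof.
move=> Gp.
suff qP h : exists g, forall x, `|g - iota (p x)| = `|h - iota x|.
  by have [q] := choice qP; exists q.
have eps_gt0 n : 0 < 2^-1 ^+ n :> K by rewrite exprn_gt0.
have [y yP] := choice (fun n => completion_dense h (eps_gt0 n)).
have pN u v : `|iota (p u) - iota (p v)| = `|iota u - iota v|.
  rewrite -!linearB !completion_norm /dot_norm.
  by rewrite (orthogonal_group_isometry G_group Gp).
have e0 : (2^-1 ^+ n : K) @[n --> \oo] --> (0 : K).
  by apply: cvg_expr; rewrite ger0_norm// invf_lt1// ltr1n.
have yh : iota (y n) @[n --> \oo] --> h.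
  apply/cvgrPdist_lt => e egt0; move/cvgrPdist_lt/(_ _ egt0) : e0.
  by apply: filterS => n /=; rewrite sub0r normrN ger0_norm ?(ltW (eps_gt0 n))//; exact: lt_trans.
have ycauchy : cauchy (iota (p (y n)) @[n --> \oo]).
  apply/cauchyP => e egt0; have e20 : 0 < e / 2 by rewrite divr_gt0.
  have /cvgrPdist_lt /(_ _ e20) [N _ NP] := yh.
  exists (iota (p (y N))), N => // n /= Nn; rewrite -ball_normE/= pN.
  rewrite -(subrK h (iota (y N))) -addrA (le_lt_trans (ler_normD _ _))// [e]splitr ltrD//.
    by rewrite distrC; exact: (NP N (leqnn N)).
  exact: (NP n Nn).
have ylim : cvg (iota (p (y n)) @[n --> \oo]) by exact: cauchy_cvg.
exists (lim (iota (p (y n)) @[n --> \oo])) => x.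
have h1 : `|iota (p (y n)) - iota (p x)| @[n --> \oo] -->
    `|lim (iota (p (y n)) @[n --> \oo]) - iota (p x)|.
  by apply: cvg_norm; apply: cvgB => //; exact: cvg_cst.
have h2 : `|iota (p (y n)) - iota (p x)| @[n --> \oo] --> `|h - iota x|.
  under eq_fun do rewrite pN.
  by apply: cvg_norm; apply: cvgB => //; exact: cvg_cst.
exact: cvg_unique h1 h2.
Qed.

Lemma follows_norm q p h : follows q p -> `|q h| = `|h|.
Proof.
have [p0 i0] : p 0 = 0 /\ iota 0 = 0 by rewrite !linear0.
by move=> /(_ h 0); rewrite p0 i0 !subr0.
Qed.

(** Squaring the equality of distances and cancelling the preserved norms leaves the inner products;
    linearity of [q] is not assumed. *)
Lemma follows_dot q p h x : G p -> follows q p ->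
  dotH (iota (p x)) (q h) = dotH (iota x) h.
Proof.
move=> Gp qp; have := qp h x.
move=> /(congr1 (fun t => t ^+ 2)); rewrite !normE !sqr_dot_norm !dotBB.
rewrite -!sqr_dot_norm -!normE (follows_norm _ qp) !completion_norm.
have -> : dot_norm dotX (p x) = dot_norm dotX x.
  by rewrite /dot_norm (orthogonal_group_isometry G_group Gp).
by rewrite (dotC dotH (q h)) (dotC dotH h); lra.
Qed.

(** Every element of [R] is some [p r'], and [iota (p r')] pairs with [q u - q v] as [iota r'] does
    with [u - v]. *)
Lemma small_follows q p e u v : G p -> follows q p ->
  small dotH (iota @` R) e (u - v) -> small dotH (iota @` R) e (q u - q v).
Proof.
move=> Gp qp suv _ [r Rr <-]; move: Rr; rewrite -(G_R Gp) => -[r' Rr' <-].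
by rewrite linearBr/= !(follows_dot _ _ Gp qp) -linearBr; apply: suv; exists r'.
Qed.

Lemma follows_completion q p x : follows q p -> q (iota x) = iota (p x).
Proof.
by move=> qp; apply/eqP; rewrite -subr_eq0 -normr_eq0 qp subrr normr0.
Qed.

End OrbitSpaceTheory.

(** * Topology and compactness of the orbit space *)

Section OrbitSpaceCompactness.
Context {K : realType} {X : lmodType K} (dotX : {dot X for @idfun K}).
Variables (R : set X) (G : set {linear X -> X}).
Hypothesis G_group : orthogonal_group dotX G.
Hypothesis G_R : forall p : {linear X -> X}, G p -> p @` R = R.
Context {H : completeNormedModType K} (dotH : {dot H for @idfun K}).
Variable iota : {linear X -> H}.
Hypothesis H_completion : hilbert_completion dotX dotH iota.

Let A : set H := iota @` R.
Let B : topologicalType := ball_space dotH A.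
Let Q := extended_group iota G.

Let Qfollows q : Q q -> exists2 p, G p & follows iota q p.
Proof. exact: (extended_group_follows G_group H_completion). Qed.

Let Qexists p : G p -> exists2 q, Q q & follows iota q p.
Proof.
move=> Gp; have [q qp] := follows_exists G_group H_completion Gp.
by exists q => //; exact: (follows_extended_group H_completion Gp qp).
Qed.

Definition orbit_class (x : B) : orbit_space dotH A Q :=
  \pi_(orbit_space dotH A Q)%qT x.

Lemma orbit_classE (c : orbit_space dotH A Q) : exists x, c = orbit_class x.
Proof. by exists (repr c); rewrite /orbit_class reprK. Qed.

(** Classes are defined by equality of orbits; this amounts to membership because the extended maps
    inherit identity, composition and inverses from [G]. *)
Lemma orbit_classP (x y : B) :
  orbit_class x = orbit_class y <-> exists2 q, Q q & set_val y = q (set_val x).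
Proof.
have -> : (orbit_class x = orbit_class y) <-> ball_orbit Q x = ball_orbit Q y.
  split; first by move=> /eqquotP/asboolP.
  by move=> xy; apply/eqquotP/asboolP.
split=> [xy|[q Qq yqx]].
  suff : ball_orbit Q x y by [].
  rewrite xy; have [q Qq qid] := Qexists (orthogonal_group1 G_group).
  exists q => //; apply: (follows_uniq H_completion) => u.
  exact/esym/(qid _ u).
have [p Gp qp] := Qfollows Qq.
have [p' Gp' [pK p'K]] := orthogonal_groupV G_group Gp.
have [q' Qq' q'p'] := Qexists Gp'.
have comp q1 q2 : Q q1 -> Q q2 -> Q (q1 \o q2).
  move=> Qq1 Qq2; have [[p1 Gp1 f1] [p2 Gp2 f2]] := (Qfollows Qq1, Qfollows Qq2).
  apply: (follows_extended_group H_completion (orthogonal_groupM G_group Gp1 Gp2)).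
  by move=> h u /=; rewrite f1 f2.
have qK h : q' (q h) = h.
  by apply: (follows_uniq H_completion) => u; rewrite -{1}[u]pK q'p' qp.
apply/seteqP; split=> z [q1 Qq1 zq1].
  exists (q1 \o q'); first exact: comp.
  by rewrite zq1 yqx /= qK.
exists (q1 \o q); first exact: comp.
by rewrite zq1 yqx.
Qed.

Lemma ball_space_norm (x : B) : `|set_val x : H| <= 1.
Proof.
by have := set_valP x; rewrite /dot_unit_ball/= -(hilbert_completion_norm H_completion).
Qed.

Lemma ball_space_elt (h : H) : `|h| <= 1 -> exists x : B, set_val x = h :> H.
Proof.
move=> h1; have hB : (h : d_space dotH A) \in (dot_unit_ball dotH : set (d_space dotH A)).
  by rewrite inE /dot_unit_ball/= -(hilbert_completion_norm H_completion).
by exists (SigSub hB); rewrite set_valE.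
Qed.

Lemma nbhs_ball_space (x : B) (P : set B) : nbhs x P <->
  exists2 e : K, 0 < e & forall y : B, small dotH A e (set_val x - set_val y : H) -> P y.
Proof.
split.
  move=> [U [[V oV <-] Vx] UP].
  have /nbhs_ballP[e /= e0 eV] : nbhs (set_val x) V by apply: open_nbhs_nbhs.
  (* Half the radius, since a pointwise strict bound gives only a non-strict one on the supremum. *)
  exists (e / 2); first by rewrite divr_gt0.
  move=> y xy.
  apply: UP; apply: eV; apply: small_ball xy.
  by rewrite ltr_pdivrMr// ltr_pMr// ltr1n.
move=> [e e0 eP].
pose f := set_val : B -> d_space dotH A.
have : nbhs x (f @^-1` ball (f x) e).
  exact: (@initial_continuous _ _ f x _ (nbhsx_ballx _ _ e0)).
by apply: filterS => y /small_sub_ball; exact: eP.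
Qed.

(* The margin [e < b] makes the set open: [small] only bounds a family of
   scalars pointwise, not its supremum. *)
Definition near_translate (a b : K) (z : X) (x : B) :=
  exists (p : {linear X -> X}) (h : H) (e : K),
    [/\ G p, `|h - iota (p z)| < a, e < b & small dotH A e (set_val x - h)].

(** Saturation: openness in the quotient can be tested on the set itself. *)
Lemma near_translate_orbit a b z x y : orbit_class x = orbit_class y ->
  near_translate a b z x -> near_translate a b z y.
Proof.
move=> /orbit_classP[q Qq yq] [p [h [e [Gp hz eb xh]]]].
have [p' Gp' qp'] := Qfollows Qq.
exists (p' \o p), (q h), e; split => //; first exact: (orthogonal_groupM G_group).
  by rewrite qp'.
by rewrite yq; exact: (small_follows G_group G_R H_completion Gp' qp').
Qed.

Lemma open_near_translate a b z :
  open [set c | exists2 x, c = orbit_class x & near_translate a b z x].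
Proof.
rewrite /open/= /quotient_open openE => x [y xy yz].
have {y xy yz}[p [h [e [Gp hz eb xh]]]] := near_translate_orbit (esym xy) yz.
apply/nbhs_ball_space; exists ((b - e) / 2) => [|y xy].
  by rewrite divr_gt0// subr_gt0.
exists y => //; exists p, h, (e + (b - e) / 2); split => //; first by lra.
have -> : (set_val y - h : H) = (set_val x - h) - (set_val x - set_val y).
  by rewrite opprB [RHS]addrC addrA subrK.
by apply: smallD => //; apply/smallN.
Qed.

(** The precision [b z] may depend on the net point, since all radii are fixed before a finite
    subcover is extracted. *)
Lemma orbit_space_compact_cover (a : K) (b : X -> K) :
  compact [set: orbit_space dotH A Q] -> 0 < a -> (forall z, 0 < b z) ->
  exists Z : set X, finite_set Z /\ Z `<=` dot_unit_ball dotX /\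
    forall x, dot_unit_ball dotX x ->
      exists (z : X) (p : {linear X -> X}), Z z /\ G p /\
        exists2 v : H, `|v| < a & small dotH A (b z) (iota (x - p z) - v).
Proof.
move=> cQ a0 b0.
(* [N z] is empty for [z] outside the unit ball, so the subcover can be cut down to that ball. *)
pose N z : set (orbit_space dotH A Q) := [set c | dot_unit_ball dotX z /\
  exists2 x, c = orbit_class x & near_translate a (b z) z x].
have [|Z finZ ZN] := @compact_finite_cover _ _ N cQ.
  move=> c; have [x ->] := orbit_classE c.
  have [z zB xz] := completion_dense_ball H_completion (ball_space_norm x) a0.
  exists z; apply: (@filterS _ _ _ [set c | exists2 x, c = orbit_class x &
      near_translate a (b z) z x]); first by move=> ? ?; split.
  apply: open_nbhs_nbhs; split; first exact: open_near_translate.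
  exists x => //; exists idfun, (set_val x), (b z / 2); split => //.
  - exact: (orthogonal_group1 G_group).
  - by rewrite ltr_pdivrMr// ltr_pMr// ltr1n.
  - by rewrite subrr; apply: small0; rewrite divr_gt0.
exists (Z `&` dot_unit_ball dotX); split; first exact: finite_setIl.
split; first by move=> z [].
move=> x xB; have [|y yx] := @ball_space_elt (iota x).
  by rewrite (completion_norm H_completion).
have [z Zz [zB [y' yy' /(near_translate_orbit (esym yy'))]]] := ZN (orbit_class y).
move=> [p [h [e [Gp hz eb yh]]]].
exists z, p; split => //; split => //; exists (h - iota (p z)) => //.
apply: (smallW (ltW eb)); move: yh; rewrite yx; congr (small _ _ _ _).
by rewrite linearB opprB addrA subrK.
Qed.

Variable M : K.
Hypotheses (M1 : 1 <= M) (RM : forall r, R r -> dot_norm dotX r <= M).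

Lemma small_norm (e : K) (u : H) : `|u| < e / M -> small dotH A e u.
Proof.
move=> ue _ [r Rr <-]; have M0 : 0 < M by exact: lt_le_trans ltr01 M1.
rewrite (le_lt_trans (cauchy_schwarz _ _ _))//.
rewrite -!(hilbert_completion_norm H_completion) (completion_norm H_completion).
rewrite (@le_lt_trans _ _ (M * `|u|)) ?ler_wpM2r ?RM//.
by rewrite mulrC -ltr_pdivlMr.
Qed.

Definition near_orbit (e : K) (z : X) : set (orbit_space dotH A Q) :=
  [set c | exists2 x, c = orbit_class x &
    exists2 p, G p & small dotH A e (set_val x - iota (p z))].

Lemma near_orbit_cover e Z : 0 < e ->
  orbit_net dotX R G Z (dot_unit_ball dotX) e ->
  forall c, exists2 z, Z z & near_orbit (e + e) z c.
Proof.
move=> e0 netZ c; have [x ->] := orbit_classE c.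
have M0 : 0 < M by exact: lt_le_trans ltr01 M1.
have [u uB xu] := completion_dense_ball H_completion (ball_space_norm x) (divr_gt0 e0 M0).
have [z [p [Zz [Gp uz]]]] := netZ _ uB.
exists z => //; exists x => //; exists p => //.
rewrite -(subrK (iota u) (set_val x : H)) -addrA.
apply: smallD; first exact: small_norm.
by rewrite -linearB; apply/(small_completion R H_completion).
Qed.

(** The map [q] sending [x1] to [x2] carries the first approximation to [x2]; the triangle
    inequality then compares [p (p1 z1)] with [p2 z2]. *)
Lemma near_orbit_inter e1 e2 z1 z2 c : near_orbit e1 z1 c -> near_orbit e2 z2 c ->
  exists2 p, G p & small dotX R (e1 + e2) (z1 - p z2).
Proof.
move=> [x1 -> [p1 Gp1 xz1]] [x2 /orbit_classP[q Qq xq] [p2 Gp2 xz2]].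
have [p Gp qp] := Qfollows Qq.
have Gpp1 := orthogonal_groupM G_group Gp Gp1.
have [p' Gp' [p'K pK']] := orthogonal_groupV G_group Gpp1.
exists (p' \o p2); first exact: (orthogonal_groupM G_group).
apply/(small_orthogonal G_group G_R _ _ Gpp1).
rewrite [X in small _ _ _ X](_ : _ = p (p1 z1) - p2 z2); last first.
  by rewrite linearB; congr (_ - _); exact: (pK' (p2 z2)).
apply/(small_completion R H_completion); rewrite linearB.
rewrite -(subrK (set_val x2 : H) (iota _)) -addrA; apply: smallD => //.
rewrite -smallN opprB xq -(follows_completion _ qp).
exact: (small_follows G_group G_R H_completion Gp qp).
Qed.

Lemma orbit_space_compact :
  (forall e, 0 < e -> exists Z : set X, finite_set Z /\
    Z `<=` dot_unit_ball dotX /\ orbit_net dotX R G Z (dot_unit_ball dotX) e) ->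
  compact [set: orbit_space dotH A Q].
Proof.
move=> net; rewrite compact_ultra => F FU _.
have eps_gt0 n : 0 < 2^-1 ^+ n :> K by rewrite exprn_gt0.
have half n : 2^-1 ^+ n.+1 + 2^-1 ^+ n.+1 = 2^-1 ^+ n :> K.
  by rewrite exprS; lra.
(* A net of precision [2^-1 ^+ n.+2] covers the orbit space by finitely many sets of radius
   [2^-1 ^+ n.+1]; one of them lies in [F]. *)
have /choice[z zP] n : exists z, dot_unit_ball dotX z /\ F (near_orbit (2^-1 ^+ n.+1) z).
  have [Z [finZ [ZB netZ]]] := net _ (eps_gt0 n.+2).
  have [z Zz Fz] := ultra_finite_cover FU finZ (near_orbit_cover (eps_gt0 _) netZ).
  by exists z; split; [exact: ZB|rewrite -half].
have /choice[p pP] n : exists p, G p /\ small dotX R (2^-1 ^+ n) (z n - p (z n.+1)).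
  have [c [c1 c2]] := filter_ex (filterI (zP n).2 (zP n.+1).2).
  have [p Gp zpz] := near_orbit_inter c1 c2; exists p; split => //.
  apply: smallW zpz; rewrite -(half n) lerD2l.
  by rewrite -(half n.+1) lerDl ltW.
(* [g n] composes the successive alignments, so [w n] and [w n.+1] are as close as [z n] and
   [p n (z n.+1)]. *)
pose g := fix g n : {linear X -> X} :=
  if n is n'.+1 then (g n' \o p n')%FUN else idfun.
have Gg n : G (g n).
  elim: n => [|n IH] /=; first exact: (orthogonal_group1 G_group).
  by apply: (orthogonal_groupM G_group) => //; exact: (pP n).1.
pose w n := iota (g n (z n)).
have [] := small_cauchy_limit (hilbert_completion_norm H_completion) (A := A) (w := w).
- move=> n; rewrite (completion_norm H_completion).
  exact: (orthogonal_unit_ball G_group (Gg n) (zP n).1).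
- move=> n; rewrite -linearB; apply/(small_completion R H_completion).
  rewrite -[g n.+1 (z n.+1)]/(g n (p n (z n.+1))) -linearB.
  by apply/(small_orthogonal G_group G_R _ _ (Gg n)); exact: (pP n).2.
move=> h [h1 wh]; have [hB hBE] := ball_space_elt h1.
exists (orbit_class hB); split => // U hU.
have : nbhs hB (orbit_class @^-1` U) by exact: (pi_continuous hU).
move=> /nbhs_ball_space[e e0 eU].
have /cvgrPdist_lt /(_ (e / 4)) : (2^-1 ^+ n : K) @[n --> \oo] --> (0 : K).
  by apply: cvg_expr; rewrite ger0_norm// invf_lt1// ltr1n.
move=> [|n _ /(_ n (leqnn n))/=]; first by rewrite divr_gt0.
rewrite sub0r normrN ger0_norm ?(ltW (eps_gt0 n))// => ne.
(* A class chosen at stage [n] has a representative near [w n]: apply to [x] the map following [g n]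
   composed with the inverse of [p1]. *)
apply: filterS (zP n).2 => c [x -> [p1 Gp1 xz]].
have [p' Gp' [p'K pK']] := orthogonal_groupV G_group Gp1.
have Ggp := orthogonal_groupM G_group (Gg n) Gp'.
have [q Qq qp] := Qexists Ggp.
have [y yE] : exists y : B, set_val y = q (set_val x) :> H.
  by apply: ball_space_elt; rewrite (follows_norm _ qp) ball_space_norm.
have -> : orbit_class x = orbit_class y by apply/orbit_classP; exists q.
apply: eU; rewrite hBE yE.
have -> : h - q (set_val x) = (h - w n) + (w n - q (set_val x)) by rewrite addrA subrK.
(* The bound [2 * 2^-1 ^+ n] is relaxed to [3 * 2^-1 ^+ n] for strictness; the total is below
   [4 * 2^-1 ^+ n < e]. *)
apply: (@smallW _ _ _ _ (3 * 2^-1 ^+ n + 2^-1 ^+ n.+1)).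
  by have := half n; have := eps_gt0 n.+1; lra.
apply: smallD.
  move=> r Ar; rewrite -opprB linearNr normrN (le_lt_trans (wh n r Ar))//.
  by rewrite ltr_pM2r// ltr_nat.
have -> : w n = q (iota (p1 (z n))).
  by rewrite (follows_completion _ qp) /= p'K.
rewrite -smallN opprB.
exact: (small_follows G_group G_R H_completion Ggp qp).
Qed.

End OrbitSpaceCompactness.

(** * Orthogonal families *)

Lemma lp_norm_ge0 (K : realType) (p : \bar K) n (v : 'I_n -> K) : 0 <= lp_norm p v.
Proof. by case: p => [p| |] //=; [exact: powR_ge0|exact: bigmax_ge_id]. Qed.

(** Powers of [d <= 1] do not increase with the exponent, so the bound at [t = s] serves all larger
    [t]. *)
Lemma exists_powR_le (K : realType) (e s : K) : 0 < e -> 0 < s ->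
  exists d, [/\ 0 < d & forall t, s <= t -> d `^ t <= e].
Proof.
move=> e0 s0; exists (Num.min 1 (e `^ s^-1)).
have d0 : 0 < Num.min 1 (e `^ s^-1) by rewrite lt_min ltr01 powR_gt0.
split => // t st; apply: (@le_trans _ _ (Num.min 1 (e `^ s^-1) `^ s)).
  by apply: ger_powR => //; rewrite d0 ge_min lexx.
rewrite [leRHS](_ : e = (e `^ s^-1) `^ s); last first.
  by rewrite -powRrM mulVf ?gt_eqF// powRr1// ltW.
by rewrite ge0_ler_powR ?(ltW s0)// ?nnegrE ?powR_ge0 ?(ltW d0)// ge_min lexx orbT.
Qed.

(** The sum is at most twice the maximum [m], and 2 to the power [t] is at most 4; one constant
    serves both [t < 1] and [t >= 1]. *)
Lemma powR_normD_le (K : realType) (a b t : K) : 0 <= t -> t <= 2 ->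
  `|a + b| `^ t <= 4 * (`|a| `^ t + `|b| `^ t).
Proof.
move=> t0 t2; set m := Num.max `|a| `|b|.
have m0 : 0 <= m by rewrite le_max normr_ge0.
apply: (@le_trans _ _ ((2 * m) `^ t)).
  rewrite ge0_ler_powR ?nnegrE ?mulr_ge0// (le_trans (ler_normD _ _))//.
  by rewrite mulr_natl mulr2n lerD// le_max lexx ?orbT.
rewrite powRM// ler_pM ?powR_ge0//.
  have -> : 4 = 2 `^ 2 :> K by rewrite powR_mulrn// -natrX.
  by apply: ler_powR => //; rewrite ler1n.
rewrite /m; have [_|_] := leP `|a| `|b|; first by rewrite lerDr powR_ge0.
by rewrite lerDl powR_ge0.
Qed.

Section OrthogonalFamilies.
Context {K : realType} {X : lmodType K} (dotX : {dot X for @idfun K}).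
Variables (R : set X) (G : set {linear X -> X}).

Definition orthogonal_family_net (eps : K) (f : X -> nat) (Z : set X) :=
  finite_set Z /\ Z `<=` dot_unit_ball dotX /\
  forall x, dot_unit_ball dotX x ->
    exists (z : X) (p : {linear X -> X}), Z z /\ G p /\
      forall (t : K) (r : 'I_(f z) -> X), eps <= t -> t <= 2 ->
        (forall i, R (r i)) -> pairwise_orthogonal_family dotX r ->
        \sum_(i < f z) `|dotX (r i) (x - p z)| `^ t <=
          eps * (1 + lp_norm (2%:E / (2 - t)%:E)%E
                       (fun i => dot_norm dotX (r i) `^ t)).

Lemma orthogonal_family_net_ball (M : K) :
  (forall r, R r -> dot_norm dotX r <= M) ->
  (forall (eps : K) (f : X -> nat), 0 < eps -> (forall y, (0 < f y)%N) ->
    exists Z, orthogonal_family_net eps f Z) ->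
  forall e, 0 < e -> exists Z : set X, finite_set Z /\
    Z `<=` dot_unit_ball dotX /\ orbit_net dotX R G Z (dot_unit_ball dotX) e.
Proof.
move=> RM net e e0; have M0 : 0 < 1 + `|M| by rewrite ltr_wpDr.
(* [eps <= 1] admits [t = 1], where the exponent is 2 and a one-term family has the norm of [r]; the
   other bound gives [eps * (1 + |M|) <= e / 2]. *)
pose eps := Num.min 1 (e / (2 * (1 + `|M|))).
have eps0 : 0 < eps by rewrite lt_min ltr01 divr_gt0// mulr_gt0.
have [Z [finZ [ZB netZ]]] := net eps (fun=> 1%N) eps0 (fun=> isT).
exists Z; split => //; split => // x /netZ[z [p [Zz [Gp zP]]]].
exists z, p; split => //; split => // r Rr.
have := zP 1 (fun=> r); rewrite ler1n ge_min lexx => /(_ isT isT (fun=> Rr)).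
have orth : pairwise_orthogonal_family dotX (fun _ : 'I_1 => r).
  by move=> i j; rewrite (ord1 i) (ord1 j) eqxx.
move=> /(_ orth); rewrite big_ord1 powRr1//.
have -> : 2 - 1 = 1 :> K by lra.
rewrite inver oner_eq0 invr1 -EFinM mulr1 /lp_norm big_ord1 -powRrM divff//.
rewrite powRr1 ?dot_norm_ge0// powRr1// (ger0_norm (dot_norm_ge0 _ _)).
move=> /le_lt_trans; apply.
have rM : 1 + dot_norm dotX r <= 1 + `|M|.
  by rewrite lerD2l (le_trans (RM _ Rr))// ler_norm.
apply: (le_lt_trans (ler_wpM2l (ltW eps0) rM)).
rewrite -ltr_pdivlMr// gt_min; apply/orP; right.
by rewrite ltr_pdivrMr ?mulr_gt0// mulrCA divfK ?gt_eqF// ltr_pMl// ltr1n.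
Qed.

Hypothesis G_group : orthogonal_group dotX G.
Hypothesis G_R : forall p : {linear X -> X}, G p -> p @` R = R.
Context {H : completeNormedModType K} (dotH : {dot H for @idfun K}).
Variable iota : {linear X -> H}.
Hypothesis H_completion : hilbert_completion dotX dotH iota.

Lemma orbit_space_compact_orthogonal_family_net :
  compact [set: orbit_space dotH (iota @` R) (extended_group iota G)] ->
  forall (eps : K) (f : X -> nat), 0 < eps -> (forall y, (0 < f y)%N) ->
    exists Z, orthogonal_family_net eps f Z.
Proof.
move=> cQ eps f eps0 f0.
have fR0 z : 0 < (f z)%:R :> K by rewrite ltr0n.
(* The factor 4 of [powR_normD_le] is absorbed by [eps / 4], spent once on the part of [v] and once,
   in [f z] equal shares, on the rest. *)
have [a [a0 aP]] := exists_powR_le (divr_gt0 eps0 (ltr0n K 4)) eps0.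
have bP z : exists b : K, [/\ 0 < b & forall t, eps <= t -> b `^ t <= eps / 4 / (f z)%:R].
  by apply: exists_powR_le => //; rewrite !divr_gt0.
have [b {}bP] := choice bP.
have b0 y : 0 < b y by have [] := bP y.
have [Z [finZ [ZB ZP]]] := orbit_space_compact_cover G_group G_R H_completion cQ a0 b0.
exists Z; split => //; split => // x /ZP[z [p [Zz [Gp [v va xv]]]]].
exists z, p; split => //; split => // t r et t2 Rr orth.
have t0 : 0 < t by exact: lt_le_trans et.
have isoH := hilbert_completion_isometry H_completion.
have orthH : pairwise_orthogonal_family dotH (iota \o r).
  by move=> i j ij; rewrite /= isoH; exact: orth.
set u := iota (x - p z) - v in xv.
set L := lp_norm _ _; have L0 : 0 <= L by exact: lp_norm_ge0.
have term i : `|dotX (r i) (x - p z)| `^ t <=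
    4 * (eps / 4 / (f z)%:R) + 4 * `|dotH (iota (r i)) v| `^ t.
  rewrite -isoH -[iota (x - p z)](subrK v) -/u linearDr.
  rewrite (le_trans (powR_normD_le _ _ (ltW t0) t2))// mulrDr lerD2r ler_pM2l//.
  have [_ /(_ t et)] := bP z; apply: le_trans.
  rewrite ge0_ler_powR ?nnegrE ?(ltW t0) ?(ltW (b0 z))//.
  by apply/ltW/xv; exists (r i).
apply: (le_trans (ler_sum _ (fun i _ => term i))).
rewrite big_split/= sumr_const card_ord -mulr_sumr mulrDr mulr1; apply: lerD.
  by rewrite -[leLHS]mulr_natr -mulrA divfK ?gt_eqF// mulrC divfK ?pnatr_eq0.
have vv : dotH v v <= a ^+ 2.
  rewrite -sqr_dot_norm -(hilbert_completion_norm H_completion).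
  by rewrite lerXn2r ?nnegrE ?(ltW a0)// ltW.
have := hoelder_bessel orthH t0 t2 a0 vv.
rewrite (_ : (fun i => dot_norm dotH ((iota \o r) i) `^ t) =
  (fun i => dot_norm dotX (r i) `^ t)) -/L; last first.
  by apply/funext => i; rewrite /dot_norm /= isoH.
move=> h; have := ler_wpM2r L0 (aP t et); move: h.
by move=> /= h1 h2; lra.
Qed.

End OrthogonalFamilies.

(** * Assembly of the equivalence *)

Theorem theorem1 (K : realType)
  (X : lmodType K) (dotX : {dot X for @idfun K})
  (R : set X) (R_bounded : dot_bounded dotX R) (R_span : spanning R)
  (G : set {linear X -> X}) (G_group : orthogonal_group dotX G)
  (G_R : forall p : {linear X -> X}, G p -> p @` R = R)
  (H : completeNormedModType K) (dotH : {dot H for @idfun K})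
  (iota : {linear X -> H}) (H_completion : hilbert_completion dotX dotH iota) :
  [<->
    (* (i) *)
    forall k : nat, (0 < k)%N ->
      exists2 Z : set X, finite_set Z &
        forall x, signed_sums R k x ->
          exists (z : X) (p : {linear X -> X}), Z z /\ G p /\
            forall r, R r -> dotX r (x - p z) ^+ 2 <= 1 ;
    (* (ii) *)
    forall eps : K, 0 < eps ->
      exists Z : set X, finite_set Z /\ Z `<=` dot_unit_ball dotX /\
        forall x, dot_unit_ball dotX x ->
          exists (z : X) (p : {linear X -> X}), Z z /\ G p /\
            forall r, R r -> `|dotX r (x - p z)| < eps ;
    (* (iii): [2%:E / 0%:E] is [+oo], so the exponent is [+oo] at [t = 2] *)
    forall (eps : K) (f : X -> nat), 0 < eps -> (forall y, (0 < f y)%N) ->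
      exists Z : set X, finite_set Z /\ Z `<=` dot_unit_ball dotX /\
        forall x, dot_unit_ball dotX x ->
          exists (z : X) (p : {linear X -> X}), Z z /\ G p /\
            forall (t : K) (r : 'I_(f z) -> X), eps <= t -> t <= 2 ->
              (forall i, R (r i)) -> pairwise_orthogonal_family dotX r ->
              \sum_(i < f z) `|dotX (r i) (x - p z)| `^ t <=
                eps * (1 + lp_norm (2%:E / (2 - t)%:E)%E
                             (fun i => dot_norm dotX (r i) `^ t)) ;
    (* (iv) *)
    compact [set: orbit_space dotH (iota @` R) (extended_group iota G)] ].
Proof.
(* Taking [M] at least 1 keeps divisions by [M] legitimate and gives [d / M ^+ 2 <= d]. *)
have [M [M1 RM]] : exists M : K, 1 <= M /\ forall r, R r -> dot_norm dotX r <= M.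
  have [M RM] := R_bounded; exists (Num.max 1 M); rewrite le_max lexx.
  by split => // r Rr; rewrite le_max RM ?orbT.
have ii_iv := orbit_space_compact G_group G_R H_completion M1 RM.
have iv_iii := orbit_space_compact_orthogonal_family_net G_group G_R H_completion.
have iii_ii := orthogonal_family_net_ball RM.
(* The cycle (i), (ii), (iii), (iv) is obtained by composing (ii) to (iv), (iv) to (iii) and (iii)
   to (ii) with the two passages between (i) and (ii). *)
tfae.
- exact: (signed_sums_net_ball G_group G_R M1 RM).
- by move=> /ii_iv/iv_iii.
- by move=> /iii_ii/ii_iv.
- by move=> /iv_iii/iii_ii; exact: (ball_net_signed_sums M1 RM).
Qed.
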